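(* Let $(G,i)$ be a filter pair over $\Sigma$ and $A$ a $\Sigma$-structure. Then the closure operator on $A$ associated to the consequence relation $\vdash_G^A$ on $A$ is the one given by $i_A\circ\Xi(i)_A$; that is, for all $D\subseteq A$ and $a\in A$, $D\vdash_G^A a$ if and only if $a\in i_A(\Xi(i)_A(D))$.
   Context: $\Sigma$-Str is the category of $\Sigma$-structures and homomorphisms. $AL$ is the category of algebraic lattices with maps preserving arbitrary meets and directed joins. A filter pair over $\Sigma$ is a pair $(G,i)$ of a contravariant functor $G:\Sigma\text{-Str}\to AL$ and maps $i_A:G(A)\to(\mathcal{P}(A),\subseteq)$, one for each $\Sigma$-structure $A$, preserving arbitrary infima (in particular $i_A(\top)=A$) and directed suprema, such that $i_A\circ G(h)=h^{-1}\circ i_B$ for every homomorphism $h:A\to B$. The consequence relation $\vdash_G^A$ on $A$: $D\vdash_G^A a$ iff for every $z\in G(A)$, $D\subseteq i_A(z)$ implies $a\in i_A(z)$. Since $i_A$ preserves arbitrary infima it has a unique left adjoint, denoted $\Xi(i)_A:\mathcal{P}(A)\to G(A)$; thus $\Xi(i)_A(D)\leq z\iff D\subseteq i_A(z)$. *)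

(* Defs.v *)
From HB Require Import structures.
From mathcomp Require Import all_boot all_order.
From mathcomp Require Import boolp classical_sets.

Set Implicit Arguments.
Unset Strict Implicit.
Unset Printing Implicit Defensive.

Import Order.TTheory.
Local Open Scope classical_set_scope.
Local Open Scope order_scope.

(* [Sigma n] is the set of n-ary operation symbols. *)
Definition signature := nat -> Type.

Record structure (Sigma : signature) := Structure {
  carrier :> Type;
  interp : forall n : nat, Sigma n -> ('I_n -> carrier) -> carrier }.

Record hom (Sigma : signature) (A B : structure Sigma) := Hom {
  hom_fun :> A -> B;
  hom_interp : forall (n : nat) (s : Sigma n) (a : 'I_n -> A),
    hom_fun (interp s a) = interp s (hom_fun \o a) }.

Definition hom_id (Sigma : signature) (A : structure Sigma) : hom A A :=
  @Hom Sigma A A idfun (fun _ _ _ => erefl).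

Lemma hom_comp_subproof (Sigma : signature) (A B C : structure Sigma)
    (g : hom B C) (f : hom A B) (n : nat) (s : Sigma n) (a : 'I_n -> A) :
  (g \o f) (interp s a) = interp s ((g \o f) \o a).
Proof. by rewrite /= !hom_interp. Qed.

Definition hom_comp (Sigma : signature) (A B C : structure Sigma)
    (g : hom B C) (f : hom A B) : hom A C :=
  Hom (hom_comp_subproof g f).

Definition directed d (P : porderType d) (S : set P) : Prop :=
  S !=set0 /\
  forall x y, S x -> S y -> exists z, [/\ S z, x <= z & y <= z].

(* [infimums S] and [supremums S] are the sets of greatest lower bounds and
   of least upper bounds of S: they have at most one element, and S may be
   empty. On [set A] the order is inclusion. *)
Definition complete d (P : porderType d) : Prop :=
  forall S : set P, infimums S !=set0 /\ supremums S !=set0.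

Definition compact_elt d (P : porderType d) (c : P) : Prop :=
  forall (S : set P) (s : P), directed S -> supremums S s -> c <= s ->
  exists2 x, S x & c <= x.

Definition compactly_generated d (P : porderType d) : Prop :=
  forall x : P, supremums [set c | compact_elt c /\ c <= x] x.

Record algLattice := AlgLattice {
  al_disp : Order.disp_t;
  al_sort :> porderType al_disp;
  al_complete : complete al_sort;
  al_compactly_generated : compactly_generated al_sort }.

(* With S empty: f preserves the top element. *)
Definition preserves_infs d d' (P : porderType d) (Q : porderType d')
    (f : P -> Q) : Prop :=
  forall (S : set P) (x : P), infimums S x -> infimums (f @` S) (f x).

Definition preserves_directed_sups d d' (P : porderType d) (Q : porderType d')
    (f : P -> Q) : Prop :=
  forall (S : set P) (x : P),
    directed S -> supremums S x -> supremums (f @` S) (f x).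

Record alHom (L M : algLattice) := ALHom {
  al_fun :> L -> M;
  al_fun_infs : preserves_infs al_fun;
  al_fun_directed_sups : preserves_directed_sups al_fun }.

Record filterPair (Sigma : signature) := FilterPair {
  fp_G : structure Sigma -> algLattice;
  fp_Gmap : forall A B : structure Sigma, hom A B -> alHom (fp_G B) (fp_G A);
  fp_Gmap_id : forall (A : structure Sigma) (z : fp_G A),
    fp_Gmap (hom_id A) z = z;
  fp_Gmap_comp : forall (A B C : structure Sigma) (g : hom B C) (f : hom A B)
      (z : fp_G C),
    fp_Gmap (hom_comp g f) z = fp_Gmap f (fp_Gmap g z);
  fp_i : forall A : structure Sigma, fp_G A -> set A;
  fp_i_infs : forall A : structure Sigma, preserves_infs (@fp_i A);
  fp_i_directed_sups : forall A : structure Sigma,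
    preserves_directed_sups (@fp_i A);
  fp_i_natural : forall (A B : structure Sigma) (h : hom A B) (z : fp_G B),
    fp_i (fp_Gmap h z) = h @^-1` (fp_i z) }.

Definition entails (Sigma : signature) (F : filterPair Sigma)
    (A : structure Sigma) (D : set A) (a : A) : Prop :=
  forall z : fp_G F A, D `<=` fp_i z -> fp_i z a.

Definition closure_of (T : Type) (vdash : set T -> T -> Prop) (D : set T) :
  set T := [set a | vdash D a].

Definition closure_operator (T : Type) (c : set T -> set T) : Prop :=
  [/\ forall D, D `<=` c D,
      forall D E, D `<=` E -> c D `<=` c E &
      forall D, c (c D) = c D].

Lemma closure_of_entails (Sigma : signature) (F : filterPair Sigma)
  (A : structure Sigma) : closure_operator (closure_of (@entails Sigma F A)).
Proof.
split=> [D a Da z|D E DE a Da z Ez|D]; first exact.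
  by apply: Da => b /DE /Ez.
apply/seteqP; split=> a /= Ha z Dz; last by apply: Dz; apply: Ha.
by apply: Ha => b; apply.
Qed.

Definition is_left_adjoint d d' (P : porderType d) (Q : porderType d')
    (l : P -> Q) (r : Q -> P) : Prop :=
  forall (x : P) (y : Q), l x <= y <-> x <= r y.

Lemma left_adjoint_unique d d' (P : porderType d) (Q : porderType d')
    (l l' : P -> Q) (r : Q -> P) :
  is_left_adjoint l r -> is_left_adjoint l' r -> l = l'.
Proof.
move=> lr l'r; apply/funext => x; apply/le_anti/andP; split.
  by apply/lr/l'r.
by apply/l'r/lr.
Qed.

Lemma left_adjoint_exists d (P : porderType d) (L : algLattice) (r : L -> P) :
  preserves_infs r -> exists l : P -> L, is_left_adjoint l r.
Proof.
move=> r_inf; pose S x := [set z | x <= r z].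
exists (fun x => sval (cid (al_complete (S x)).1)) => x y.
case: cid => m /= m_inf; have [m_lb _] := m_inf.
have [_ rm_glb] := r_inf _ _ m_inf.
have x_rm : x <= r m by apply: rm_glb => _ [z Sz <-].
split=> [m_y|x_ry]; last exact: m_lb.
apply: (le_trans x_rm).
have m_inf2 : infimums [set m; y] m.
  split; first by move=> _ [->|->].
  by move=> z; apply; left.
have [rm_lb _] := r_inf _ _ m_inf2.
by apply: rm_lb; exists y => //; right.
Qed.

Definition left_adjoint d (P : porderType d) (L : algLattice) (r : L -> P)
    (r_infs : preserves_infs r) : P -> L :=
  sval (cid (left_adjoint_exists r_infs)).

Definition Xi (Sigma : signature) (F : filterPair Sigma)
    (A : structure Sigma) : set A -> fp_G F A :=
  left_adjoint (@fp_i_infs Sigma F A).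

Lemma Xi_adjoint (Sigma : signature) (F : filterPair Sigma)
    (A : structure Sigma) (D : set A) (z : fp_G F A) :
  Xi F D <= z <-> D `<=` fp_i z.
Proof.
by rewrite -subsetEset; apply: (svalP (cid (left_adjoint_exists _))).
Qed.

(* Main.v *)
Require Import Defs.
From mathcomp Require Import all_boot all_order.
From mathcomp Require Import boolp classical_sets.
Local Open Scope classical_set_scope.

(** By the adjunction, the [z] whose filter [fp_i z] contains [D] are exactly those above [Xi F D],
    which is itself one of them. Since [fp_i] is monotone, [fp_i (Xi F D)] is the least filter
    containing [D], hence the intersection of all such filters, and that intersection is the closure
    of [D] under [entails]. *)

Lemma subset_fp_i_Xi (Sigma : signature) (F : filterPair Sigma)
    (A : structure Sigma) (D : set A) : D `<=` fp_i (Xi F D).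
Proof. by apply/Xi_adjoint; exact: Order.POrderTheory.lexx. Qed.

(** A right adjoint is monotone: the counit gives [Xi F (fp_i x) <= x <= y], which transposes
    back. *)
Lemma fp_i_le (Sigma : signature) (F : filterPair Sigma)
    (A : structure Sigma) (x y : fp_G F A) :
  (x <= y)%O -> fp_i x `<=` fp_i y.
Proof.
move=> xy; apply/Xi_adjoint; apply: (Order.POrderTheory.le_trans _ xy).
exact/Xi_adjoint.
Qed.

Theorem proposition2p7 (Sigma : signature) (F : filterPair Sigma)
    (A : structure Sigma) :
  closure_of (@entails Sigma F A) = (@fp_i Sigma F A) \o (@Xi Sigma F A) /\
  (forall (D : set A) (a : A), entails F D a <-> fp_i (Xi F D) a).
Proof.
have entailsE (D : set A) (a : A) : entails F D a <-> fp_i (Xi F D) a.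
  split=> [Da|iXa z Dz]; first by apply: Da; exact: subset_fp_i_Xi.
  (* [Dz] transposes to [Xi F D <= z], so [iXa] carries over to [z]. *)
  by apply: fp_i_le iXa; apply/Xi_adjoint.
split=> //; apply/funext => D; apply/seteqP.
by split=> a /= /entailsE.
Qed.
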